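(* Let $A,C,H$ be three logically independent events, with $P(ACH)>0$. Then $\mathbb{P}[A|((C|A)\wedge(A|H))]=P(A\vee H)$.
   Context: Events. An event is a two-valued (true/false) logical entity, identified with its $0/1$ indicator; $\Omega$ and $\emptyset$ are the sure and impossible events, $AB$ denotes $A\wedge B$, and $\overline{A}$ is the negation of $A$. The constituents generated by finitely many events are the non-impossible conjunctions obtained by choosing each event or its negation; $n$ events are logically independent if they generate $2^n$ constituents. An event $E$ is identified with $E|\Omega$. Conditional random quantities. For an event $H\neq\emptyset$ and a finite-valued random quantity $X$ with assessed prevision $\mathbb{P}(X|H)=\mu$, the conditional random quantity $X|H$ is $X|H=XH+\mu\overline{H}$. When $X$ is (the indicator of) an event $A$, $\mathbb{P}(A|H)=P(A|H)$ and $A|H$ is the (indicator of the) conditional event, with values $1$, $0$, $P(A|H)$ according to whether $AH$, $\overline{A}H$, $\overline{H}$ is true. Conjunction. The conjunction $(E_1|H_1)\wedge\cdots\wedge(E_n|H_n)$ is the conditional random quantity, with conditioning event $H_1\vee\cdots\vee H_n$, taking value $1$ if all $E_iH_i$ are true, $0$ if some $\overline{E}_iH_i$ is true, $x_S$ if $(\bigwedge_{i\in S}\overline{H}_i)\wedge(\bigwedge_{i\notin S}E_iH_i)$ is true ($\emptyset\ne S\subsetneq\{1,\dots,n\}$), where $x_S$ is the prevision of $\bigwedge_{i\in S}(E_i|H_i)$, and its own prevision if all $H_i$ are false. Generalized iterated conditional. If $\mathcal{C}_n=(E_1|H_1)\wedge\cdots\wedge(E_n|H_n)$ is not identically $0$,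 then $(E_{n+1}|H_{n+1})|\mathcal{C}_n$ is the random quantity $\mathcal{C}_n\wedge(E_{n+1}|H_{n+1})+\mu(1-\mathcal{C}_n)$, where $\mu$ is its own prevision. In the present case, with $y=P(A|H)$ and $z=\mathbb{P}[(C|A)\wedge(A|H)]$: $(C|A)\wedge(A|H)$ has values $1$ on $ACH$, $y$ on $AC\overline{H}$, $0$ on $A\overline{C}\vee\overline{A}H$, $z$ on $\overline{A}\,\overline{H}$ (conditioning event $A\vee H$); $A\wedge(C|A)\wedge(A|H)=AC\wedge(A|H)$ has values $1$ on $ACH$, $y$ on $AC\overline{H}$, $0$ otherwise; and $A|((C|A)\wedge(A|H))=AC\wedge(A|H)+\mu(1-(C|A)\wedge(A|H))$ with $\mu=\mathbb{P}[A|((C|A)\wedge(A|H))]$. Coherence. A bet on an object $Z$ with assessed prevision $\mu$ and stake $s\in\mathbb{R}$ has random gain $s(Z-\mu)$. The bet is called off in a constituent if there one receives back the paid amount $\mu$ whatever the value of $\mu$ (for $X|H$: when $\overline{H}$ is true; for a generalized iterated conditional this may depend on the preliminary probability values). An assessment of previsions is coherent if, for every finite subfamily of objects and all real stakes, the total gain $G$, restricted to the constituents in which not all the bets are called off, satisfies $\min G\le 0\le\max G$. Coherent previsions are linear. All probabilities and previsions are assumed to come from a coherent assessment on all objects involved. *)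

(* Defs.v *)
From mathcomp Require Import all_boot all_order all_algebra.
From mathcomp Require Import boolp classical_sets functions cardinality.
From mathcomp Require Import reals numfun.

Set Implicit Arguments.
Unset Strict Implicit.
Unset Printing Implicit Defensive.

Import Order.TTheory GRing.Theory Num.Theory.

Local Open Scope classical_set_scope.
Local Open Scope ring_scope.

(* Events are subsets of an arbitrary type [Omega] of possible worlds; by Stone
   duality any Boolean algebra of events is an algebra of such subsets. *)

Definition constituents (Omega : Type) (s : seq (set Omega)) :
    set (set Omega) :=
  [set B | B !=set0 /\
     exists2 b : seq bool, size b = size s &
       B = \big[setI/setT]_(p <- zip b s) (if p.1 then p.2 else ~` p.2)].

Definition logically_independent (Omega : Type) (s : seq (set Omega)) : Prop :=
  (constituents s #= `I_(2 ^ size s))%card.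

(* [Given E H] is the pair underlying the conditional event E|H. *)
Record condevent (Omega : Type) : Type :=
  Given { consequent : set Omega; antecedent : set Omega }.

(* Names of the objects whose previsions are assessed. The random quantities
   they denote ([value]) depend on the assessment itself, which is therefore a
   function on names. [Conj] is only meant for at least two conjuncts: use
   [conjunction], which sends a single conditional event to E|H itself. *)
Inductive object (R : Type) (Omega : Type) : Type :=
| Cond of (Omega -> R) & set Omega
| Conj of seq (condevent Omega)
| Iter of condevent Omega & seq (condevent Omega).

Arguments Cond {R Omega} X H.
Arguments Conj {R Omega} s.
Arguments Iter {R Omega} c s.

Section Objects.
Variables (R : realType) (Omega : Type).
Implicit Types (c : condevent Omega) (s : seq (condevent Omega)) (w : Omega).

Definition sure (E : set Omega) : condevent Omega := Given E setT.

Definition cond_event c : object R Omega :=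
  Cond \1_(consequent c) (antecedent c).

Definition event (E : set Omega) : object R Omega := cond_event (sure E).

Definition conjunction s : object R Omega :=
  if s is [:: c] then cond_event c else Conj s.

Definition is_void c w : bool := w \notin antecedent c.
Definition is_false c w : bool :=
  (w \in antecedent c) && (w \notin consequent c).

Variable P : object R Omega -> R.

Definition cond_value (X : Omega -> R) (H : set Omega) (mu : R) w : R :=
  X w * \1_H w + mu * \1_(~` H) w.

(* [mu] is the prevision of the conjunction itself; the x_S attached to a
   proper nonempty subfamily of void conjuncts is read off from [P]. *)
Definition conj_value s (mu : R) w : R :=
  let void := [seq c <- s | is_void c w] in
  if has (is_false^~ w) s then 0
  else if size void == 0%N then 1
  else if size void == size s then mu
  else P (conjunction void).

Definition conjunction_value s w : R := conj_value s (P (conjunction s)) w.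

(* The random quantity denoted by [o] when the prevision of [o] is [mu] and
   all the other previsions are given by [P]. *)
Definition value (o : object R Omega) (mu : R) w : R :=
  match o with
  | Cond X H => cond_value X H mu w
  | Conj s => conj_value s mu w
  | Iter c s =>
      conjunction_value (rcons s c) w + mu * (1 - conjunction_value s w)
  end.

Definition admissible (o : object R Omega) : Prop :=
  let possible c := antecedent c != set0 in
  match o with
  | Cond X H => H != set0 /\ finite_set (range X)
  | Conj s => (1 < size s)%N /\ all possible s
  | Iter c s => [/\ (0 < size s)%N, possible c, all possible s
                 & exists w, conjunction_value s w != 0]
  end.

(* Only the prevision of [o] itself varies: the others stay fixed at [P], so for
   iterated conditionals this may depend on [P]. *)
Definition called_off (o : object R Omega) w : Prop :=
  forall mu : R, value o mu w = mu.

Definition gain (n : nat) (o : 'I_n -> object R Omega) (a : 'I_n -> R) w : R :=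
  \sum_(i < n) a i * (value (o i) (P (o i)) w - P (o i)).

(* The restriction of [P] to the family [K] is coherent. A gain takes finitely
   many values, so min G <= 0 <= max G says that G takes a nonpositive and a
   nonnegative value; gains and called-off conditions are constant on the
   constituents, so quantifying over worlds is quantifying over constituents.
   A subfamily may be listed with repetitions: this only splits stakes. *)
Definition coherent (K : set (object R Omega)) : Prop :=
  (forall o, K o -> admissible o) /\
  forall (n : nat) (o : 'I_n -> object R Omega) (a : 'I_n -> R),
    (0 < n)%N -> (forall i, K (o i)) ->
    let active := [set w | exists i, ~ called_off (o i) w] in
    (exists2 w, active w & gain o a w <= 0) /\
    (exists2 w, active w & 0 <= gain o a w).

End Objects.

Arguments event {R Omega} E.
Arguments cond_event {R Omega} c.
Arguments conjunction {R Omega} s.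

(* Main.v *)
Require Import Defs.
From mathcomp Require Import all_boot all_order all_algebra.
From mathcomp Require Import boolp classical_sets functions cardinality.
From mathcomp Require Import reals numfun.
From mathcomp Require Import ring lra.

Import Order.TTheory GRing.Theory Num.Theory.
Local Open Scope classical_set_scope.
Local Open Scope ring_scope.

(** Write [z] for the prevision of [(C|A) /\ (A|H)], [p] for that of [A \/ H]
    and [mu] for that of the iterated conditional. Conjoining [A] with
    [(C|A) /\ (A|H)] changes nothing on [A \/ H]: if [A] is false and [H] true
    then [A|H] is false already. Off [A \/ H], it replaces the value [z] by
    [0]. So [A /\ (C|A) /\ (A|H)] is the conjunction minus [z] times the
    indicator of [~ (A \/ H)], and its prevision should be
    [z - z * (1 - p) = z * p]; by definition of the iterated conditional it
    should also be [mu * z].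

    The triple conjunction is not itself assessed, so the comparison is made by
    a bet: stakes [1], [mu - 1] and [- z] on the iterated conditional, the
    conjunction and [A \/ H] give in every world the same gain [z * (p - mu)].
    A coherent assessment allows no sure nonzero gain, hence
    [z * (p - mu) = 0] ([prevision_conj_iter]). One may divide by [z] because
    a bet on the conjunction against [A /\ C /\ H] excludes [z <= 0]
    ([prevision_conj_gt0]). *)

Section Coherence.
Variables (R : realType) (Omega : Type).
Variables (P : object R Omega -> R) (K : set (object R Omega)).
Hypothesis coh : coherent P K.

(** A single bet on [E|H] is active only on [H], where its value is an
    indicator; this excludes a negative prevision. *)
Lemma prevision_cond_event_ge0 (c : condevent Omega) :
  K (cond_event c) -> 0 <= P (cond_event c).
Proof.
move=> Kc; have [_ no_sure_win] := coh.
have [] := no_sure_win 1%N (fun=> cond_event c) (fun=> 1) isT (fun=> Kc).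
move=> [w [_ not_off]] + _.
have wH : w \in antecedent c.
  apply/negP => /negP wNH; apply: not_off => mu.
  by rewrite /= /cond_value !indicE in_setC (negbTE wNH) /= mulr0 add0r mulr1.
rewrite /gain big_ord_recl big_ord0 /= /cond_value !indicE in_setC wH /=.
by rewrite mulr1 mulr0 !addr0 mul1r subr_le0; apply: le_trans; rewrite ler0n.
Qed.

(** Coherence tests only the worlds in which some bet is active; a gain that is
    the same in all worlds makes that restriction harmless. *)
Lemma coherent_constant_gain (n : nat) (o : 'I_n -> object R Omega)
    (a : 'I_n -> R) (g : R) :
  (0 < n)%N -> (forall i, K (o i)) -> (forall w, gain P o a w = g) -> g = 0.
Proof.
move=> n_gt0 Ko gainE; have [_ no_sure_gain] := coh.
have [[w _ +] [w' _]] := no_sure_gain n o a n_gt0 Ko.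
by rewrite !gainE => g_le0 g_ge0; apply/eqP; rewrite eq_le g_le0.
Qed.

End Coherence.

Arguments prevision_cond_event_ge0 {R Omega P K} coh {c}.
Arguments coherent_constant_gain {R Omega P K} coh {n} o a {g}.

Section IteratedConditional.
Variables (R : realType) (Omega : Type) (A C H : set Omega).
Variables (P : object R Omega -> R).

Let CA_AH := [:: Given C A; Given A H].

Lemma value_event (E : set Omega) mu w : value P (event E) mu w = \1_E w.
Proof. by rewrite /= /cond_value indicT setCT indic0 /= mulr1 mulr0 addr0. Qed.

Lemma conj_value_CA_AH mu w : conj_value P CA_AH mu w =
  if w \in A then
    if w \in C then if w \in H then 1 else P (cond_event (Given A H)) else 0
  else if w \in H then 0 else mu.
Proof.
rewrite /conj_value /CA_AH /= /is_false /is_void /=.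
by case: (w \in A); case: (w \in C); case: (w \in H).
Qed.

Lemma conj_value_CA_AH_A mu w : conj_value P (rcons CA_AH (sure A)) mu w =
  if (w \in A) && (w \in C) then
    if w \in H then 1 else P (cond_event (Given A H))
  else 0.
Proof.
rewrite /conj_value /CA_AH /= /is_false /is_void /= in_setT.
by case: (w \in A); case: (w \in C); case: (w \in H).
Qed.

Variable K : set (object R Omega).
Hypotheses (coh : coherent P K) (K_conj : K (conjunction CA_AH)).

(** With [conj = triple + z * ~ (A \/ H)] and the iterated conditional
    [triple + mu * (1 - conj)], the stakes are those that eliminate [triple] and
    then [~ (A \/ H)]; only the difference of the two sides remains. *)
Lemma prevision_conj_iter :
    K (event (A `|` H)) -> K (Iter (sure A) CA_AH) ->
  P (conjunction CA_AH) * P (event (A `|` H)) =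
  P (conjunction CA_AH) * P (Iter (sure A) CA_AH).
Proof.
move=> K_AH K_iter.
set z := P (conjunction _); set p := P (event _); set mu := P (Iter _ _).
pose o (i : 'I_3) : object R Omega := nth (event (A `|` H))
  [:: Iter (sure A) CA_AH; conjunction CA_AH; event (A `|` H)] i.
pose a (i : 'I_3) := nth 0 [:: 1; mu - 1; - z] i.
apply/eqP; rewrite -subr_eq0 -mulrBr; apply/eqP.
apply: (coherent_constant_gain coh o a) => //.
  by case=> [[|[|[|]]]].
move=> w; rewrite /gain !big_ord_recl big_ord0 /o /a.
rewrite [nth _ _ _]/= [nth _ _ (lift _ _)]/= [nth _ _ (lift _ (lift _ _))]/=.
rewrite value_event -/p -/z -/mu indicE in_setU [value _ (Iter _ _) _ _]/=.
rewrite /conjunction_value conj_value_CA_AH_A [value _ _ z _]conj_value_CA_AH.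
rewrite conj_value_CA_AH.
by case: (w \in A); case: (w \in C); case: (w \in H) => /=; rewrite -/z; ring.
Qed.

(** Bet [1] on the conjunction and [-1] on [A /\ C /\ H], of prevision [q > 0].
    The conjunction differs from [A /\ C /\ H] only where it is partly void, with
    value [P(A|H) >= 0], or wholly void, and there its bet is called off. So the
    gain is at least [q - z] where it is not wholly void and [q] where it is, and
    [z <= 0] would make it a sure win. *)
Lemma prevision_conj_gt0 :
    K (event (A `&` C `&` H)) -> K (cond_event (Given A H)) ->
    0 < P (event (A `&` C `&` H)) ->
  0 < P (conjunction CA_AH).
Proof.
move=> K_ACH K_AgH; set z := P (conjunction _); set q := P (event _) => q_gt0.
have y_ge0 := prevision_cond_event_ge0 coh K_AgH.
rewrite ltNge; apply/negP => z_le0; have [_ no_sure_win] := coh.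
pose o (i : 'I_2) : object R Omega := nth (event (A `&` C `&` H))
  [:: conjunction CA_AH; event (A `&` C `&` H)] i.
pose a (i : 'I_2) : R := nth 0 [:: 1; -1] i.
have Ko i : K (o i) by case: i => [[|[|]]].
have [[w _] + _] := no_sure_win 2%N o a isT Ko.
rewrite /gain !big_ord_recl big_ord0 /o /a.
rewrite [nth _ _ _]/= [nth _ _ (lift _ _)]/=.
rewrite value_event -/q -/z indicE !in_setI [value _ _ z _]conj_value_CA_AH.
by case: (w \in A); case: (w \in C); case: (w \in H) => /=; lra.
Qed.

End IteratedConditional.

Arguments prevision_conj_iter {R Omega A C H P K} coh.
Arguments prevision_conj_gt0 {R Omega A C H P K} coh.

Theorem theorem14 (R : realType) (Omega : Type) (A C H : set Omega)
    (K : set (object R Omega)) (P : object R Omega -> R)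
    (indep : logically_independent [:: A; C; H])
    (coh : coherent P K)
    (K_ACH : K (event (A `&` C `&` H)))
    (K_AH : K (event (A `|` H)))
    (K_CgA : K (cond_event (Given C A)))
    (K_AgH : K (cond_event (Given A H)))
    (K_conj : K (conjunction [:: Given C A; Given A H]))
    (K_iter : K (Iter (sure A) [:: Given C A; Given A H]))
    (pos : 0 < P (event (A `&` C `&` H))) :
  P (Iter (sure A) [:: Given C A; Given A H]) = P (event (A `|` H)).
Proof.
have z_gt0 := prevision_conj_gt0 coh K_conj K_ACH K_AgH pos.
have := prevision_conj_iter coh K_conj K_AH K_iter.
by move=> /(mulfI (lt0r_neq0 z_gt0)) ->.
Qed.
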